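(* Let $H$ act irreducibly on a finite-dimensional complex vector space $V$, either as a compact group acting unitarily or as a complex reductive group acting rationally, and suppose there are constants $0 \leq \theta < 1$ and $C_0 \geq 1$ such that $$\dim W \geq \theta \dim V \quad \Longrightarrow \quad \mathrm{diam}_+^{H}(V, W) \leq C_0$$ for every nonzero subspace $W \leq V$. Then $$\mathsf{C}(V) \leq C_0 \max\Bigl\{1, \ \ln \frac{1}{1-\theta} + \theta\Bigr\}.$$
   Context: For a group $H$ acting linearly on a finite-dimensional complex vector space $V$ and a nonzero subspace $U \leq V$, the group-additive diameter is $$\mathrm{diam}_+^{H}(V,U) = \min\{ m \mid g_1\cdot U + \dots + g_m\cdot U = V \text{ for some } g_1,\dots,g_m \in H\}.$$ If $H$ acts irreducibly on $V$, put $\mathsf{R}(V,U) = \mathrm{diam}_+^{H}(V,U) / \lceil \dim V/\dim U\rceil$, and the covering complexity of $V$ (with respect to $H$) is $\mathsf{C}(V) = \max_{0 \neq U \leq V} \mathsf{R}(V,U)$. Representations of compact groups are continuous; a complex reductive group is a complex reductive linear algebraic group. *)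

(* Defs.v *)
From HB Require Import structures.
From mathcomp Require Import all_boot all_order all_algebra.
From mathcomp Require Import sesquilinear complex.
From mathcomp Require mpoly.
From mathcomp Require Import all_classical all_reals all_analysis.

Set Implicit Arguments.
Unset Strict Implicit.
Unset Printing Implicit Defensive.

Import Order.TTheory GRing.Theory Num.Theory.
Local Open Scope classical_set_scope.
Local Open Scope ring_scope.
Local Open Scope complex_scope.

HB.mixin Record isTopologicalGroup G of Group G & Topological G := {
  mulg_continuous : continuous (fun x : G * G => (x.1 * x.2)%g) ;
  invg_continuous : continuous (fun x : G => x^-1%g)
}.

#[short(type="topologicalGroupType")]
HB.structure Definition TopologicalGroup :=
  {G of Group G & Topological G & isTopologicalGroup G}.

Section Representations.
Variables (R : realType) (V : vectType R[i]).

Section Rep.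
Variables (H : groupType) (rho : H -> 'End(V)).

Definition representation :=
  rho 1%g = \1%VF /\ forall g h, rho (g * h)%g = (rho g \o rho h)%VF.

Definition irreducible :=
  fullv != 0%VS :> {vspace V} /\
  forall W : {vspace V}, (forall g, rho g @: W <= W)%VS ->
    W = 0%VS \/ W = fullv.

Definition covers (U : {vspace V}) (m : nat) :=
  exists g : 'I_m -> H, (\sum_(i < m) rho (g i) @: U)%VS = fullv.

(* The minimum of the lengths m of covering families; it is +oo when there is
   none, and is attained otherwise (diam_attained). *)
Definition diam (U : {vspace V}) : \bar R :=
  ereal_inf [set m%:R%:E | m in covers U].

Definition covering_ratio (U : {vspace V}) : \bar R :=
  (diam U *
   ((Num.ceil ((\dim (@fullv _ V))%:R / (\dim U)%:R : R))%:~R^-1)%:E)%E.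

(* The supremum is attained if rho is an irreducible representation
   (covering_complexity_attained). *)
Definition covering_complexity : \bar R :=
  ereal_sup [set covering_ratio U | U in [set U | U != 0%VS]].

Definition unitary_action :=
  exists dot : {dot V for Num.conj}, forall g, isometry dot dot (rho g).

End Rep.

(* Continuity of all matrix coefficients, C carrying its usual topology. *)
Definition continuous_rep (K : topologicalGroupType) (rho : K -> 'End(V)) :=
  forall (l : 'Hom(V, R[i]^o)) (v : V),
    continuous (fun g => l (rho g v) : R[i]^o).

End Representations.

Section LinearAlgebraicGroups.
Variables (R : realType) (m : nat).

Definition eval_mx (p : mpoly.mpoly (m * m) R[i]) (A : 'M[R[i]]_m) : R[i] :=
  mpoly.meval (fun k => mxvec A 0 k) p.

(* Zariski closed subsets of GL_m; since det is a unit there, the equations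
   can be taken polynomial in the entries. *)
Definition zariski_closed_GL (X : set 'M[R[i]]_m) :=
  exists S : set (mpoly.mpoly (m * m) R[i]),
    X = [set A | A \in unitmx /\ forall p, S p -> eval_mx p A = 0].

Definition zariski_connected (X : set 'M[R[i]]_m) :=
  forall A B, zariski_closed_GL A -> zariski_closed_GL B ->
    X `<=` A `|` B -> X `&` A `&` B = set0 -> X `<=` A \/ X `<=` B.

Definition unipotent_mx (A : 'M[R[i]]_m) := exists k, (A - 1%:M) ^+ k = 0.

Variables (H : groupType) (phi : H -> 'M[R[i]]_m).

(* phi identifies H with a Zariski closed subgroup of GL_m. *)
Definition linear_algebraic_group :=
  [/\ phi 1%g = 1%:M,
      forall g h, phi (g * h)%g = phi g *m phi h,
      injective phi &
      zariski_closed_GL (range phi)].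

Definition normal_subgroup (N : set H) :=
  [/\ N 1%g,
      forall x y, N x -> N y -> N (x * y)%g,
      forall x, N x -> N (x^-1)%g &
      forall g x, N x -> N (g * x * g^-1)%g].

(* The unipotent radical is trivial; connectedness is not required. *)
Definition reductive :=
  forall N : set H, normal_subgroup N ->
    zariski_closed_GL (phi @` N) -> zariski_connected (phi @` N) ->
    (forall x, N x -> unipotent_mx (phi x)) ->
    N = [set 1%g].

(* Every matrix coefficient is a regular function, i.e. the restriction to H
   of an element of C[x_ij, 1/det]. *)
Definition rational_rep (V : vectType R[i]) (rho : H -> 'End(V)) :=
  forall (l : 'Hom(V, R[i]^o)) (v : V),
    exists (p : mpoly.mpoly (m * m) R[i]) (k : nat),
      forall g, l (rho g v) = eval_mx p (phi g) / \det (phi g) ^+ k.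

End LinearAlgebraicGroups.

Variant compact_or_reductive_rep (R : realType) (V : vectType R[i]) :
    forall H : groupType, (H -> 'End(V)) -> Prop :=
  | CompactUnitary (K : topologicalGroupType) (rho : K -> 'End(V)) of
      compact [set: K] & hausdorff_space K & representation rho &
      continuous_rep rho & unitary_action rho :
      compact_or_reductive_rep rho
  | ReductiveRational (H : groupType) (m : nat) (phi : H -> 'M[R[i]]_m)
      (rho : H -> 'End(V)) of
      linear_algebraic_group phi & reductive phi & representation rho &
      rational_rep phi rho :
      compact_or_reductive_rep rho.

Lemma diam_attained (R : realType) (V : vectType R[i])
    (H : groupType) (rho : H -> 'End(V)) (U : {vspace V}) m :
  covers rho U m ->
  exists m0, [/\ covers rho U m0, diam rho U = m0%:R%:E &
    forall m', covers rho U m' -> (m0 <= m')%N].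
Proof.
move=> cm.
have ex : exists m, `[< covers rho U m >] by exists m; apply/asboolP.
case: (ex_minnP ex) => m0 /asboolP c0 min0.
have min1 m' : covers rho U m' -> (m0 <= m')%N by move=> ?; apply/min0/asboolP.
exists m0; split => //; apply/eqP; rewrite eq_le; apply/andP; split.
  by apply: ereal_inf_lbound; exists m0.
by apply: le_ereal_inf_tmp => _ [m' /min1 h <-]; rewrite lee_fin ler_nat.
Qed.

Lemma irreducible_covers (R : realType) (V : vectType R[i])
    (H : groupType) (rho : H -> 'End(V)) (U : {vspace V}) :
  representation rho -> irreducible rho ->
  U != 0%VS -> exists2 m, (m <= \dim (@fullv _ V))%N & covers rho U m.
Proof.
move=> [rho1 rhoM] [_ irr] U0.
suff grow k : (k <= \dim (@fullv _ V))%N -> exists2 m, (m <= k)%N &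
    exists g : 'I_m -> H, (k <= \dim (\sum_(i < m) rho (g i) @: U)%VS)%N.
  have [m ? [g hg]] := grow _ (leqnn _); exists m => //; exists g.
  by apply/eqP; rewrite eqEdim subvf.
elim: k => [_|k IH kn]; first by exists 0%N => //; exists (fun=> 1%g).
have [m mk [g hg]] := IH (ltnW kn).
set W := (\sum_(i < m) _)%VS in hg.
case: (ltnP k (\dim W)) => [lt|ge]; first by exists m; [exact: leqW|exists g].
have [h hh] : exists h, ~~ (rho h @: U <= W)%VS.
  apply: contrapT => /forallNP noh.
  have sub h : (rho h @: U <= W)%VS by apply: contrapT => /negP /noh.
  have [T subT [TW T0]] : exists2 T : {vspace V},
      (forall h, rho h @: T <= T)%VS & (T <= W)%VS /\ T != 0%VS.
    pose P d := `[< exists n (f : 'I_n -> H),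
      \dim (\sum_(i < n) rho (f i) @: U)%VS = d >].
    have exP : exists d, P d by exists (\dim W); apply/asboolP; exists m, g.
    have bP d : P d -> (d <= \dim (@fullv _ V))%N.
      by move=> /asboolP [n [f <-]]; rewrite dimvS // subvf.
    case: (ex_maxnP exP bP) => d /asboolP [n [f fd]] dmax.
    exists (\sum_(i < n) rho (f i) @: U)%VS.
      have inT h : (rho h @: U <= \sum_(i < n) rho (f i) @: U)%VS.
        pose f' (i : 'I_n.+1) := if unlift ord0 i is Some j then f j else h.
        have e : (\sum_(i < n.+1) rho (f' i) @: U)%VS =
                 (rho h @: U + \sum_(i < n) rho (f i) @: U)%VS.
          rewrite big_ord_recl /f' unlift_none; congr (_ + _)%VS.
          by apply: eq_bigr => i _; rewrite liftK.
        apply/addv_idPr; apply/eqP; rewrite eq_sym eqEdim addvSr /= fd -e.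
        by apply: dmax; apply/asboolP; exists n.+1, f'.
      move=> h; rewrite limg_sum; apply/subv_sumP => i _.
      by rewrite -limg_comp -rhoM.
    split; first by apply/subv_sumP => i _; exact: sub.
    apply: contra_neq U0 => e0; have d0 : d = 0%N by rewrite -fd e0 dimv0.
    apply/eqP; rewrite -dimv_eq0 -leqn0 -d0; apply: dmax; apply/asboolP.
    exists 1%N, (fun=> 1%g); rewrite big_ord1 rho1.
    by rewrite lim1g.
  case: (irr T subT) => e; first by rewrite e eqxx in T0.
  by move: kn; rewrite ltnNge -e (leq_trans (dimvS TW) ge).
exists m.+1 => //; exists (fun i => if unlift ord0 i is Some j then g j else h).
rewrite big_ord_recl unlift_none.
under eq_bigr do rewrite liftK.
rewrite -/W; apply: (leq_ltn_trans hg); rewrite ltnNge.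
apply: contra hh => le; apply/addv_idPr/eqP; rewrite eq_sym eqEdim addvSr.
exact: le.
Qed.

Lemma covering_complexity_attained (R : realType) (V : vectType R[i])
    (H : groupType) (rho : H -> 'End(V)) :
  representation rho -> irreducible rho ->
  exists2 U : {vspace V}, U != 0%VS &
    covering_complexity rho = covering_ratio rho U.
Proof.
move=> rep irr; set n := \dim (@fullv _ V).
pose F (x : 'I_n.+1 * 'I_n.+1) : \bar R :=
  (x.1%:R%:E * ((Num.ceil (n%:R / x.2%:R : R))%:~R^-1)%:E)%E.
pose P x := `[< exists2 U : {vspace V}, U != 0%VS &
    covering_ratio rho U = F x >].
have FP U : U != 0%VS -> exists2 x, P x & covering_ratio rho U = F x.
  move=> U0; have [m mn cm] := irreducible_covers rep irr U0.
  have [m0 [_ dU /(_ _ cm) m0m]] := diam_attained cm.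
  have lm : (m0 < n.+1)%N by rewrite ltnS (leq_trans m0m).
  have ld : (\dim U < n.+1)%N by rewrite ltnS dimvS ?subvf.
  have e : covering_ratio rho U = F (Ordinal lm, Ordinal ld).
    by rewrite /covering_ratio dU.
  by exists (Ordinal lm, Ordinal ld) => //; apply/asboolP; exists U.
have [x0 Px0 _] := FP _ irr.1.
case: (arg_maxP F Px0) => x /asboolP [U U0 eU] xmax.
exists U => //; apply/eqP; rewrite eq_le; apply/andP; split.
  apply: ge_ereal_sup => _ [W W0 <-].
  by have [y Py ->] := FP W W0; rewrite eU; exact: xmax.
by apply: ereal_sup_ubound; exists U.
Qed.

(* Main.v *)
Require Import Defs.
From mathcomp Require Import all_boot all_order all_algebra.
From mathcomp Require Import complex.
From mathcomp Require Import all_classical all_reals all_analysis.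
From mathcomp Require Import zify ring lra.

(** The argument uses only that rho is an irreducible representation.  Write
    n = dim V, d = dim U.  The engine is a relative-position statement
    ([exists_small_cap]): for all U and W some translate satisfies
    dim (gU :&: W) <= d * dim W / n.  For a compact group this follows by
    integrating the trace of a product of projections over the group; here it
    is obtained without any integral.  For a finite family s of group elements
    the excess of W is the sum over g in s of dim (gU :&: W) - d * dim W / n.
    It is a supermodular function of W that vanishes at 0 and at V
    ([excess_supermodular], [excess_fullv]).  By irreducibility there is one
    finite family hs whose translates of any nonzero W add up to V
    ([uniform_cover]).  If the mean excess over s is at most c, then replacing
    s by all the products h^-1 * g averages the excess over the translates h W;
    were all of these close to c, supermodularity would make the excess of their
    sum V positive.  So the bound c drops by the factor 1 - 1 / size hs
    ([excess_contraction]).  Iterating, the mean excess gets arbitrarily small,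
    and integrality of dimensions gives a single g.

    Consequently W can always be enlarged by a translate of U with
    codim (W + gU) <= (1 - d / n) codim W, so k greedily chosen translates span
    a subspace of codimension at most (1 - d / n) ^ k * n
    ([exists_growing_sum]).  Once this is at most (1 - theta) n, at most C0
    translates of that subspace cover V, and U needs at most C0 * k translates
    ([diam_le_mul]).  It remains to choose k ([steps_bound]): k = 1 if
    theta <= d / n, and otherwise the least integer above (n / d) L, with
    L = ln (1 / (1 - theta)).  With N the ceiling of n / d, it is at most
    N L + 1 <= N (L + theta), because N theta >= 1 in that case. *)

Set Implicit Arguments.
Unset Strict Implicit.
Unset Printing Implicit Defensive.

Import Order.TTheory GRing.Theory Num.Theory.

Local Open Scope ring_scope.
Local Open Scope complex_scope.

(** * Auxiliary facts *)

Lemma compact_or_reductive_representation (R : realType) (V : vectType R[i])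
    (H : groupType) (rho : H -> 'End(V)) :
  compact_or_reductive_rep rho -> representation rho.
Proof. by case. Qed.

Lemma exp1B_le_expR (R : realType) (x : R) (k : nat) :
  x <= 1 -> (1 - x) ^+ k <= expR (- (k%:R * x)).
Proof.
move=> x1; rewrite -mulrN expRM_natl lerXn2r ?nnegrE ?expR_ge0 ?subr_ge0 //.
exact: expR_ge1Dx.
Qed.

Lemma lfun_span_mem (K : fieldType) (aT rT : vectType K)
    (fs : seq 'Hom(aT, rT)) (f : 'Hom(aT, rT)) (v : aT) (T : {vspace rT}) :
  f \in <<fs>>%VS -> (forall h, h \in fs -> h v \in T) -> f v \in T.
Proof.
move=> ffs hT; have ffs' : f \in <<in_tuple fs>>%VS by [].
rewrite (coord_span ffs') sum_lfunE memv_suml // => i _.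
by rewrite scale_lfunE memvZ // hT // mem_nth.
Qed.

(** * Translates of subspaces *)

Section Translates.
Variables (R : realType) (V : vectType R[i]) (H : groupType).
Variable rho : H -> 'End(V).

Local Notation dimV := (\dim (@fullv _ V)).

Lemma covers_seqP (U : {vspace V}) (m : nat) :
  covers rho U m <->
  exists2 s : seq H, size s = m & (\sum_(g <- s) rho g @: U)%VS = fullv.
Proof.
split=> [[g gU]|[s <- sU]].
  exists [seq g i | i <- enum 'I_m]; first by rewrite size_map size_enum_ord.
  by rewrite big_map big_enum.
exists (fun i => nth 1%g s i).
by rewrite -sU (big_nth 1%g) big_mkord.
Qed.

Hypothesis rep : representation rho.

Lemma limg_mul (g h : H) (W : {vspace V}) :
  (rho (g * h)%g @: W = rho g @: (rho h @: W))%VS.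
Proof. by rewrite rep.2 limg_comp. Qed.

Lemma limg_one (W : {vspace V}) : (rho 1%g @: W)%VS = W.
Proof. by rewrite rep.1 lim1g. Qed.

Lemma lker_rep (g : H) : lker (rho g) == 0%VS.
Proof.
apply/lker0P => v w e.
have K u : rho g^-1%g (rho g u) = u.
  by rewrite -comp_lfunE -rep.2 mulVg rep.1 id_lfunE.
by rewrite -[v]K e K.
Qed.

Lemma dim_translate (g : H) (W : {vspace V}) : \dim (rho g @: W) = \dim W.
Proof. by rewrite limg_dim_eq // (eqP (lker_rep g)) capv0. Qed.

(** Moves the group element from the fixed subspace U to the varying subspace W:
    this turns averaging over families of the form h^-1 * g into averaging over
    translates of W. *)
Lemma dim_translate_cap (g h : H) (U W : {vspace V}) :
  \dim (rho (h^-1 * g)%g @: U :&: W) = \dim (rho g @: U :&: rho h @: W).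
Proof.
by rewrite -(dim_translate h) lker0_img_cap ?lker_rep // -limg_mul mulgA mulgV mul1g.
Qed.

Lemma covers_sum (s : seq H) (U : {vspace V}) (m : nat) :
  covers rho (\sum_(g <- s) rho g @: U)%VS m -> covers rho U (m * size s).
Proof.
move=> /covers_seqP [t <- e]; apply/covers_seqP.
exists [seq (h * g)%g | h <- t, g <- s]; first by rewrite size_allpairs.
rewrite big_allpairs_dep -e; apply: eq_bigr => h _.
by rewrite limg_sum; apply: eq_bigr => g _; rewrite limg_mul.
Qed.

Hypothesis irr : irreducible rho.

Lemma dimV_gt0 : (0 < dimV)%N.
Proof. by rewrite lt0n dimv_eq0 irr.1. Qed.

(** The family hs does not depend on W: its image under rho spans the same
    space of endomorphisms as rho(H).  The sum of the h W then contains every g W,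
    so it is invariant and nonzero. *)
Lemma uniform_cover : exists hs : seq H, forall W : {vspace V},
  W != 0%VS -> (\sum_(h <- hs) rho h @: W)%VS = fullv.
Proof.
pose P d := `[< exists hs : seq H, \dim <<map rho hs>> = d >].
have exP : exists d, P d.
  by exists (\dim <<map rho [::]>>); apply/asboolP; exists [::].
have bP d : P d -> (d <= \dim (@fullv _ 'End(V)))%N.
  by move=> /asboolP [hs <-]; rewrite dimvS // subvf.
case: (ex_maxnP exP bP) => d /asboolP [hs hsd] dmax.
have in_span g : rho g \in <<map rho hs>>%VS.
  have sub : (<<map rho hs>> <= <<map rho (g :: hs)>>)%VS.
    by rewrite /= span_cons addvSr.
  have /eqP -> : <<map rho hs>>%VS == <<map rho (g :: hs)>>%VS.
    rewrite eqEdim sub hsd; apply: dmax; apply/asboolP.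
    by exists (g :: hs).
  by apply: memv_span; rewrite /= mem_head.
exists hs => W W0.
set T := (\sum_(h <- hs) _)%VS.
have hT h : h \in hs -> (rho h @: W <= T)%VS.
  move=> hhs; rewrite /T (big_rem h) //=; exact: addvSl.
have gT g : (rho g @: W <= T)%VS.
  apply/subvP => _ /memv_imgP [w wW ->].
  apply: (lfun_span_mem (in_span g)) => _ /mapP [h hhs ->].
  by apply: (subvP (hT h hhs)); rewrite memv_img.
have Tinv g : (rho g @: T <= T)%VS.
  rewrite limg_sum; apply big_ind => [|X Y XT YT|h _]; first exact: sub0v.
    by rewrite subv_add XT.
  by rewrite -limg_mul.
case: (irr.2 T Tinv) => // T0.
by move: (gT 1%g); rewrite limg_one T0 subv0 (negPf W0).
Qed.

(** * Averaging without a Haar measure *)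

Section Excess.
Variable U : {vspace V}.

(** Subtracting the multiple d / n of dim W normalises the count of
    intersection dimensions so that it vanishes at both 0 and V. *)
Definition excess (s : seq H) (W : {vspace V}) : R :=
  \sum_(g <- s) ((\dim (rho g @: U :&: W))%:R
                 - (\dim U)%:R / dimV%:R * (\dim W)%:R).

Lemma excess0 (s : seq H) : excess s 0%VS = 0.
Proof. by apply: big1 => g _; rewrite capv0 dimv0 mulr0 subr0. Qed.

Lemma excess_fullv (s : seq H) : excess s fullv = 0.
Proof.
apply: big1 => g _; rewrite capvf dim_translate divfK ?subrr //.
by rewrite pnatr_eq0 -lt0n dimV_gt0.
Qed.

(** dim W is modular in W, and X :&: A + X :&: B lies in X :&: (A + B). *)
Lemma excess_supermodular (s : seq H) (A B : {vspace V}) :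
  excess s A + excess s B <= excess s (A + B)%VS + excess s (A :&: B)%VS.
Proof.
rewrite -!big_split /=; apply: ler_sum => g _; set X := (rho g @: U)%VS.
set r := _ / _.
have e : (\dim (A + B))%:R + (\dim (A :&: B))%:R = (\dim A)%:R + (\dim B)%:R :> R.
  by rewrite -!natrD dimv_sum_cap.
have l : (\dim (X :&: A))%:R + (\dim (X :&: B))%:R
      <= (\dim (X :&: (A + B)))%:R + (\dim (X :&: (A :&: B)))%:R :> R.
  rewrite -!natrD ler_nat -dimv_sum_cap leq_add //; apply: dimvS.
    by rewrite subv_add !capvS // (addvSl, addvSr).
  rewrite !subv_cap (subv_trans (capvSl _ _) (capvSl _ _)) /=.
  rewrite (subv_trans (capvSl _ _) (capvSr _ _)) /=.
  by rewrite (subv_trans (capvSr _ _) (capvSr _ _)).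
have := congr1 ( *%R r) e; lra.
Qed.

(** By supermodularity, deficits from an upper bound c are subadditive under
    sums of subspaces: the excess of the intersection is also at most c. *)
Lemma excess_sum_deficit (s hs : seq H) (W : {vspace V}) (c : R) :
  (forall X, excess s X <= c) -> hs != [::] ->
  c - excess s (\sum_(h <- hs) rho h @: W)%VS
    <= \sum_(h <- hs) (c - excess s (rho h @: W)%VS).
Proof.
move=> le_c; elim: hs => // h [|h' hs] IH _; first by rewrite !big_seq1.
rewrite big_cons [leRHS]big_cons; have := IH isT.
set B := (\sum_(j <- _) _)%VS; set A := (rho h @: W)%VS.
have := excess_supermodular s A B; have := le_c (A :&: B)%VS.
lra.
Qed.

Lemma excess_convolution (hs s : seq H) (W : {vspace V}) :
  excess [seq (h^-1 * g)%g | h <- hs, g <- s] W =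
  \sum_(h <- hs) excess s (rho h @: W)%VS.
Proof.
rewrite /excess big_allpairs_dep; apply: eq_bigr => h _; apply: eq_bigr => g _.
by rewrite dim_translate_cap dim_translate.
Qed.

(** The family h W adds up to V, whose deficit is the whole bound c (times the
    size of s); hence the deficits of the h W total at least that much, and the
    mean over h gains a fraction 1 / size hs of c. *)
Lemma excess_contraction (hs s : seq H) (c : R) :
  (forall W, W != 0%VS -> (\sum_(h <- hs) rho h @: W)%VS = fullv) ->
  hs != [::] -> 0 <= c -> (forall W, excess s W <= c * (size s)%:R) ->
  forall W, excess [seq (h^-1 * g)%g | h <- hs, g <- s] W
    <= c * (1 - (size hs)%:R^-1) * (size hs * size s)%:R.
Proof.
move=> cov hs0 c0 le_c W; rewrite natrM mulrA.
have N0 : (size hs)%:R != 0 :> R by rewrite pnatr_eq0 size_eq0.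
have -> : c * (1 - (size hs)%:R^-1) * (size hs)%:R = c * ((size hs)%:R - 1).
  by field.
have [->|W0] := eqVneq W 0%VS.
  by rewrite excess0 !mulr_ge0 // subr_ge0 ler1n lt0n size_eq0.
have := excess_sum_deficit W le_c hs0.
rewrite (cov W W0) excess_fullv excess_convolution sumrB big_const_seq.
rewrite count_predT iter_addr_0 -mulr_natr.
lra.
Qed.

(** On the trivial family the mean excess is at most d; each convolution with the
    inverses of a uniform cover multiplies the bound by q < 1. *)
Lemma excess_small (e : R) : 0 < e ->
  exists2 s : seq H, s != [::] & forall W, excess s W <= e * (size s)%:R.
Proof.
move=> e0; have [hs cov] := uniform_cover.
have hs0 : hs != [::].
  apply: contraNneq irr.1 => hs0.
  by rewrite -(cov _ irr.1) hs0 big_nil.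
set q : R := 1 - (size hs)%:R^-1.
have N1 : (size hs)%:R^-1 <= 1 :> R by rewrite invf_le1 ?ler1n ?ltr0n lt0n size_eq0.
have N0 : 0 < (size hs)%:R^-1 :> R by rewrite invr_gt0 ltr0n lt0n size_eq0.
have iterate k : exists2 s : seq H, s != [::] &
    forall W, excess s W <= (\dim U)%:R * q ^+ k * (size s)%:R.
  elim: k => [|k [s s0 le_s]].
    exists [:: 1%g] => // W; rewrite /excess big_seq1 limg_one mulr1 mulr1.
    rewrite lerBlDr (@le_trans _ _ (\dim U)%:R) // ?ler_nat ?dimvS ?capvSl //.
    by rewrite lerDl !mulr_ge0 // invr_ge0.
  exists [seq (h^-1 * g)%g | h <- hs, g <- s].
    by rewrite -size_eq0 size_allpairs muln_eq0 !size_eq0 negb_or hs0.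
  move=> W; rewrite size_allpairs exprSr mulrA.
  apply: excess_contraction => //.
  by rewrite mulr_ge0 ?exprn_ge0 // subr_ge0.
have q_ge0 : 0 <= q by rewrite subr_ge0.
have q_lt1 : `|q| < 1 by rewrite ger0_norm // /q; lra.
have [k le_k] : exists k, (\dim U)%:R * q ^+ k <= e.
  have /cvgrPdist_le /(_ e e0) [k _ /(_ k (leqnn k))] :=
    cvg_geometric (\dim U)%:R q_lt1.
  by move=> /= le; exists k; apply: le_trans (ler_norm _) _; rewrite -normrN -sub0r.
have [s s0 le_s] := iterate k; exists s => // W.
by apply: le_trans (le_s W) _; rewrite ler_wpM2r.
Qed.

(** The terms of the excess lie in (1 / n) Z, so a positive one is at least
    1 / n; a mean excess of at most 1 / (2 n) leaves no room for all of them to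
    be positive. *)
Lemma exists_small_cap (W : {vspace V}) :
  exists g, (dimV * \dim (rho g @: U :&: W) <= \dim U * \dim W)%N.
Proof.
apply: contrapT => /forallNP no.
have n0 : 0 < dimV%:R :> R by rewrite ltr0n dimV_gt0.
have e0 : 0 < (2%:R * dimV%:R)^-1 :> R by rewrite invr_gt0 mulr_gt0.
have [s s0 /(_ W)] := excess_small e0; apply/negP; rewrite -ltNge.
have s_gt0 : 0 < (size s)%:R :> R by rewrite ltr0n lt0n size_eq0.
apply: (@lt_le_trans _ _ (dimV%:R^-1 * (size s)%:R)).
  by rewrite ltr_pM2r // ltf_pV2 ?posrE ?mulr_gt0 // ltr_pMl // ltr1n.
rewrite mulr_natr -iter_addr_0 -[X in iter X]count_predT -big_const_seq.
apply: ler_sum => g _; have /negP := no g.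
rewrite -ltnNge -(ler_nat R) -natr1 !natrM -(@ler_pM2l _ dimV%:R^-1) ?invr_gt0 //.
rewrite mulKf ?gt_eqF //.
lra.
Qed.

Lemma exists_large_sum (W : {vspace V}) :
  exists g, (\dim U * (dimV - \dim W)
             <= dimV * (\dim (W + rho g @: U) - \dim W))%N.
Proof.
have [g le_cap] := exists_small_cap W; exists g.
have := dimv_sum_cap W (rho g @: U); rewrite dim_translate capvC => e.
have -> : (\dim (W + rho g @: U) - \dim W = \dim U - \dim (rho g @: U :&: W))%N.
  have := dimvS (capvSl (rho g @: U) W); rewrite dim_translate.
  lia.
by rewrite !mulnBr mulnC leq_sub2l // mulnC.
Qed.

(** Adding a best translate of U multiplies the codimension by at most
    q = 1 - d / n. *)
Lemma exists_growing_sum (k : nat) : exists2 s : seq H, size s = k &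
  dimV%:R * (1 - (1 - (\dim U)%:R / dimV%:R) ^+ k)
    <= (\dim (\sum_(g <- s) rho g @: U)%VS)%:R :> R.
Proof.
have n0 : 0 < dimV%:R :> R by rewrite ltr0n dimV_gt0.
elim: k => [|k [s sk le_s]]; first by exists [::] => //; rewrite subrr mulr0.
set W := (\sum_(g <- s) _)%VS in le_s.
have [g le_g] := exists_large_sum W.
exists (g :: s); first by rewrite /= sk.
rewrite big_cons addvC -/W; set X := (W + _)%VS.
have WX : (\dim W <= \dim X)%N by rewrite dimvS ?addvSl.
have Wn : (\dim W <= dimV)%N by rewrite dimvS ?subvf.
have Un : (\dim U <= dimV)%N by rewrite dimvS ?subvf.
move: le_g; rewrite -(ler_nat R) !natrM !natrB //.
move: le_s; rewrite -(ler_nat R) in Un.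
set n := dimV%:R in n0 *; set w := (\dim W)%:R; set x := (\dim X)%:R.
set d := (\dim U)%:R in Un *.
set q := 1 - d / n; set t := q ^+ k => le_w.
have nq : n * q = n - d by rewrite /q; field; rewrite gt_eqF.
have q0 : 0 <= q by rewrite -(pmulr_rge0 _ n0) nq subr_ge0.
rewrite exprSr -/t => le_x.
have : q * (n * (1 - t)) <= q * w by rewrite ler_wpM2l.
rewrite -(ler_pM2l n0).
have -> : n * (q * (n * (1 - t))) = n * (n - d) - n * (n * (t * q)).
  by rewrite -nq; ring.
have -> : n * (q * w) = (n - d) * w by rewrite -nq; ring.
rewrite -(ler_pM2l n0 (n * _)).
lra.
Qed.

End Excess.

(** * The covering complexity *)

Lemma diam_le_mul (theta C0 : R) (U : {vspace V}) (k : nat) : (0 < k)%N ->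
  (forall W : {vspace V}, W != 0%VS -> theta * dimV%:R <= (\dim W)%:R ->
     (diam rho W <= C0%:E)%E) ->
  U != 0%VS ->
  theta <= 1 - (1 - (\dim U)%:R / dimV%:R) ^+ k ->
  exists2 m : R, diam rho U = m%:E & m <= C0 * k%:R.
Proof.
move=> k0 hdiam U0 le_theta; have [s sk le_s] := exists_growing_sum U k.
set W := (\sum_(g <- s) _)%VS in le_s.
have W0 : W != 0%VS.
  rewrite /W; case: s sk {W le_s} => [k00|g s _]; first by rewrite -k00 in k0.
  rewrite big_cons; apply: contra U0; rewrite -!subv0 subv_add => /andP[le _].
  by rewrite subv0 -dimv_eq0 -(dim_translate g) dimv_eq0 -subv0.
have thetaW : theta * dimV%:R <= (\dim W)%:R.
  by apply: le_trans le_s; rewrite mulrC ler_wpM2l.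
have [m _ cm] := irreducible_covers rep irr W0.
have [m0 [c0 dW _]] := diam_attained cm.
have := hdiam W W0 thetaW; rewrite dW lee_fin => m0C0.
have cU := covers_sum c0.
have [m1 [_ dU /(_ _ cU) le_m1]] := diam_attained cU.
exists m1%:R => //; rewrite sk -(ler_nat R) natrM in le_m1.
by rewrite (le_trans le_m1) // ler_wpM2r.
Qed.

End Translates.

(** Here x stands for d / n and N for the ceiling of n / d. *)
Lemma steps_bound (R : realType) (theta x N : R) :
  0 <= theta < 1 -> 0 < x <= 1 -> x^-1 <= N -> 1 <= N ->
  exists2 k : nat, (0 < k)%N & theta <= 1 - (1 - x) ^+ k /\
    k%:R <= N * Num.max 1 (ln (1 / (1 - theta)) + theta).
Proof.
move=> /andP[th0 th1] /andP[x0 x1] xN N1.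
have N0 : 0 < N by apply: lt_le_trans N1.
(* A single translate is already large enough when theta <= x. *)
case: (lerP theta x) => [thx|xth].
  exists 1%N => //; split; first by rewrite expr1; lra.
  by rewrite (le_trans N1) // ler_peMr ?(ltW N0) // le_max lexx.
have Nth : 1 <= N * theta.
  apply: le_trans (ler_wpM2r th0 xN).
  by rewrite mulrC ler_pdivlMr // mul1r ltW.
set L := ln _.
have eL : expR (- L) = 1 - theta.
  by rewrite /L div1r lnV ?posrE ?subr_gt0 // opprK lnK ?posrE ?subr_gt0.
have L0 : 0 < L by rewrite -oppr_lt0 -expR_lt1 eL; lra.
have xL0 : 0 <= x^-1 * L by rewrite mulr_ge0 ?invr_ge0 ?ltW.
exists (Num.truncn (x^-1 * L)).+1 => //; split.
  suff : (1 - x) ^+ (Num.truncn (x^-1 * L)).+1 <= 1 - theta by lra.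
  rewrite -eL (le_trans (exp1B_le_expR _ x1)) // ler_expR lerN2.
  by rewrite -ler_pdivrMr // mulrC ltW // truncnS_gt.
rewrite -natr1 (@le_trans _ _ (N * (L + theta))) //; last first.
  by rewrite ler_wpM2l ?(ltW N0) // le_max lexx orbT.
have le_xL : (Num.truncn (x^-1 * L))%:R <= x^-1 * L by rewrite truncn_le.
rewrite mulrDr lerD // (le_trans le_xL) //.
by rewrite ler_wpM2r // ltW.
Qed.

Theorem proposition7p1 (R : realType) (V : vectType R[i])
    (H : groupType) (rho : H -> 'End(V)) (theta C0 : R)
    (hrho : compact_or_reductive_rep rho)
    (hirr : irreducible rho)
    (htheta : 0 <= theta < 1)
    (hC0 : 1 <= C0)
    (hdiam : forall W : {vspace V}, W != 0%VS ->
       theta * (\dim (@fullv _ V))%:R <= (\dim W)%:R ->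
       (diam rho W <= C0%:E)%E) :
  (covering_complexity rho <=
     (C0 * Num.max 1 (ln (1 / (1 - theta)) + theta))%:E)%E.
Proof.
have rep := compact_or_reductive_representation hrho.
apply: ge_ereal_sup => _ [U U0 <-]; rewrite /covering_ratio.
have n0 : 0 < (\dim (@fullv _ V))%:R :> R by rewrite ltr0n (dimV_gt0 hirr).
have d0 : 0 < (\dim U)%:R :> R by rewrite ltr0n lt0n dimv_eq0.
have dn : (\dim U)%:R <= (\dim (@fullv _ V))%:R :> R.
  by rewrite ler_nat dimvS ?subvf.
set N : R := (Num.ceil _)%:~R.
have le_N : (\dim (@fullv _ V))%:R / (\dim U)%:R <= N by exact: ceil_ge.
have N1 : 1 <= N by apply: le_trans le_N; rewrite ler_pdivlMr // mul1r.
have N0 : 0 < N by apply: lt_le_trans N1.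
have [||k k0 [grow le_k]] :=
  @steps_bound R theta ((\dim U)%:R / (\dim (@fullv _ V))%:R) N htheta _ _ N1.
- by rewrite divr_gt0 //= ler_pdivrMr // mul1r.
- by rewrite invf_div.
have [m -> le_m] := diam_le_mul rep hirr k0 hdiam U0 grow.
rewrite -EFinM lee_fin ler_pdivrMr // (le_trans le_m) // -mulrA ler_wpM2l //.
  exact: le_trans hC0.
by rewrite mulrC.
Qed.
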